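(* Let $\sigma\in[0,1]$. If $$\lambda^L\ \ge\ (1-\sigma)\max_{\substack{\boldsymbol{\mu}\in[-1,1]^{|\tau_B|}\\ \boldsymbol{C}\in\{0,1\}^{K\times|\tau_L|}}}\ \max_{j=1,\ldots,p}\left\|\nabla_{\boldsymbol{a}_{j\cdot}}g(\boldsymbol{0},\boldsymbol{\mu},\boldsymbol{C})\right\|_\infty$$ and $$\lambda^G\ \ge\ \sigma\max_{\substack{\boldsymbol{\mu}\in[-1,1]^{|\tau_B|}\\ \boldsymbol{C}\in\{0,1\}^{K\times|\tau_L|}}}\ \max_{j=1,\ldots,p}\left\|\nabla_{\boldsymbol{a}_{j\cdot}}g(\boldsymbol{0},\boldsymbol{\mu},\boldsymbol{C})\right\|_1,$$ then $\boldsymbol{a}^*=\boldsymbol{0}$ is a stationary point of the S-ORCT; that is, there exist $\boldsymbol{\mu}^*$ and $\boldsymbol{C}^*$ such that $(\boldsymbol{0},\boldsymbol{\mu}^*,\boldsymbol{C}^* )$ is feasible for the S-ORCT problem and $$-\nabla_{\boldsymbol{a}}g(\boldsymbol{0},\boldsymbol{\mu}^*,\boldsymbol{C}^* )\in\partial_{\boldsymbol{a}}\left(\lambda^L\sum_{j=1}^p\|\boldsymbol{a}_{j\cdot}\|_1+\lambda^G\sum_{j=1}^p\|\boldsymbol{a}_{j\cdot}\|_\infty\right)(\boldsymbol{0}),$$ where $\partial_{\boldsymbol{a}}$ denotes the (convex) subdifferential with respect to $\boldsymbol{a}$.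
   Context: Data: integers $D,N,p,K\ge 1$; a training sample $\{(\boldsymbol{x}_i,y_i)\}_{1\le i\le N}$ with $\boldsymbol{x}_i\in[0,1]^p$ and $y_i\in\{1,\ldots,K\}$; real misclassification costs $W_{kk'}$, $k,k'\in\{1,\ldots,K\}$ (the cost of classifying an individual of class $k$ in class $k'$); regularization parameters $\lambda^L\ge 0$, $\lambda^G\ge 0$; a univariate continuous cumulative distribution function $F$ of a continuous random variable with density $f$, centered at $0$ (a modelling convention; no further property is formally imposed), where $F$ is differentiable with $F'=f$ everywhere. Tree: the full binary tree of depth $D$, with set of branch (internal) nodes $\tau_B$, $|\tau_B|=2^D-1$, and set of leaf nodes $\tau_L$, $|\tau_L|=2^D$. For $t\in\tau_L$, $N_L(t)$ (resp. $N_R(t)$) is the set of ancestor nodes of $t$ whose left (resp. right) branch takes part in the path from the root to $t$. It is assumed that $K\le 2^D$. Notation: $\boldsymbol{a}=(a_{jt})_{j=1,\ldots,p,\,t\in\tau_B}$ is a $p\times|\tau_B|$ matrix; $\boldsymbol{a}_{j\cdot}\in\mathbb{R}^{|\tau_B|}$ is its $j$-th row and $\boldsymbol{a}_{\cdot t}$ its $t$-th column; $\boldsymbol{\mu}=(\mu_t)_{t\in\tau_B}$; $\boldsymbol{C}=(C_{kt})_{k=1,\ldots,K,\,t\in\tau_L}$. For $i=1,\ldots,N$, $$p_{it}(\boldsymbol{a}_{\cdot t},\mu_t)=F\left(\tfrac1p\boldsymbol{a}_{\cdot t}^T\boldsymbol{x}_i-\mu_t\right)\quad(t\in\tau_B),$$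 $$P_{it}(\boldsymbol{a},\boldsymbol{\mu})=\prod_{t_l\in N_L(t)}p_{it_l}(\boldsymbol{a}_{\cdot t_l},\mu_{t_l})\prod_{t_r\in N_R(t)}\left(1-p_{it_r}(\boldsymbol{a}_{\cdot t_r},\mu_{t_r})\right)\quad(t\in\tau_L),$$ $$g(\boldsymbol{a},\boldsymbol{\mu},\boldsymbol{C})=\frac1N\sum_{i=1}^N\sum_{t\in\tau_L}P_{it}(\boldsymbol{a},\boldsymbol{\mu})\sum_{k=1}^K W_{y_ik}C_{kt}.$$ $\nabla_{\boldsymbol{a}_{j\cdot}}g(\boldsymbol{0},\boldsymbol{\mu},\boldsymbol{C})\in\mathbb{R}^{|\tau_B|}$ is the gradient of $g$ with respect to the row $\boldsymbol{a}_{j\cdot}$ evaluated at $\boldsymbol{a}=\boldsymbol{0}$. The S-ORCT problem is: minimize $g(\boldsymbol{a},\boldsymbol{\mu},\boldsymbol{C})+\lambda^L\sum_{j=1}^p\|\boldsymbol{a}_{j\cdot}\|_1+\lambda^G\sum_{j=1}^p\|\boldsymbol{a}_{j\cdot}\|_\infty$ subject to $\sum_{k=1}^K C_{kt}=1$ for $t\in\tau_L$; $\sum_{t\in\tau_L}C_{kt}\ge1$ for $k=1,\ldots,K$; $a_{jt}\in[-1,1]$; $\mu_t\in[-1,1]$; $C_{kt}\in[0,1]$. A lower bound on $\lambda^L$ or $\lambda^G$ by a multiple of a maximum over $(\boldsymbol{\mu},\boldsymbol{C},j)$ is understood as the requirement that the corresponding inequality holds for every $\boldsymbol{\mu}\in[-1,1]^{|\tau_B|}$,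 $\boldsymbol{C}\in\{0,1\}^{K\times|\tau_L|}$ and $j\in\{1,\ldots,p\}$. *)

(* Defs.v *)
From HB Require Import structures.
From mathcomp Require Import all_boot all_order all_algebra.
From mathcomp Require Import all_classical all_reals all_analysis.
Set Implicit Arguments.
Unset Strict Implicit.
Unset Printing Implicit Defensive.
Import Order.TTheory GRing.Theory Num.Theory.
Import numFieldNormedType.Exports.

Local Open Scope classical_set_scope.
Local Open Scope ring_scope.

(* The nodes of the full binary tree of depth D are numbered 1, 2, ...,
   2^(D+1) - 1 in breadth-first order: the root is 1 and the children of n are
   2n (left) and 2n + 1 (right), so that the parent of n is n./2. The branch
   nodes are 1, ..., 2^D - 1 and the leaves 2^D, ..., 2^(D+1) - 1; they are
   indexed by the types 'I_(num_branch D) and 'I_(num_leaf D), from 0. *)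
Definition num_branch (D : nat) : nat := (2 ^ D - 1)%N.
Definition num_leaf (D : nat) : nat := (2 ^ D)%N.

Definition branch_node (D : nat) (t : 'I_(num_branch D)) : nat := t.+1.
Definition leaf_node (D : nat) (t : 'I_(num_leaf D)) : nat := (2 ^ D + t)%N.

Definition left_child (n : nat) : nat := n.*2.
Definition right_child (n : nat) : nat := n.*2.+1.

(* Node n lies on the path from the root to the leaf t, both included. *)
Definition on_path (D : nat) (n : nat) (t : 'I_(num_leaf D)) : bool :=
  [exists k : 'I_D.+1, iter k half (leaf_node t) == n].

Definition left_ancestors (D : nat) (t : 'I_(num_leaf D)) :
    {set 'I_(num_branch D)} :=
  [set s | on_path (left_child (branch_node s)) t]%SET.

Definition right_ancestors (D : nat) (t : 'I_(num_leaf D)) :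
    {set 'I_(num_branch D)} :=
  [set s | on_path (right_child (branch_node s)) t]%SET.

Section ORCT.
Variables (R : realType) (D N p K : nat).

Implicit Types (F : R -> R) (x : 'I_N -> 'cV[R]_p) (y : 'I_N -> 'I_K)
  (W : 'M[R]_K) (a : 'M[R]_(p, num_branch D)) (mu : 'rV[R]_(num_branch D))
  (C : 'M[R]_(K, num_leaf D)).

Definition branch_prob F x (i : 'I_N) a mu (t : 'I_(num_branch D)) : R :=
  F (p%:R^-1 * ((col t a)^T *m x i) ord0 ord0 - mu ord0 t).

Definition leaf_prob F x (i : 'I_N) a mu (t : 'I_(num_leaf D)) : R :=
  (\prod_(s in left_ancestors t) branch_prob F x i a mu s) *
  (\prod_(s in right_ancestors t) (1 - branch_prob F x i a mu s)).

Definition cost F x y W a mu C : R :=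
  N%:R^-1 * \sum_(i < N) \sum_(t < num_leaf D)
    leaf_prob F x i a mu t * (\sum_(k < K) W (y i) k * C k t).

Definition feasible a mu C : Prop :=
  [/\ forall t, \sum_(k < K) C k t = 1,
      forall k, 1 <= \sum_(t < num_leaf D) C k t,
      forall j t, -1 <= a j t <= 1,
      forall t, -1 <= mu ord0 t <= 1 &
      forall k t, 0 <= C k t <= 1].

End ORCT.

(* The gradient, as the matrix of all partial derivatives; its j-th row is the
   gradient with respect to the j-th row of the argument. *)
Definition gradient (R : realType) (m n : nat) (phi : 'M[R]_(m, n) -> R)
    (A : 'M[R]_(m, n)) : 'M[R]_(m, n) :=
  \matrix_(i < m, j < n) 'D_(delta_mx i j) phi A.

Definition norm1 (R : realType) (n : nat) (v : 'rV[R]_n) : R :=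
  \sum_(t < n) `|v ord0 t|.

(* The library norm `|v| of a row vector is the maximum norm. *)
Definition penalty (R : realType) (p n : nat) (lamL lamG : R)
    (a : 'M[R]_(p, n)) : R :=
  lamL * (\sum_(j < p) norm1 (row j a)) + lamG * (\sum_(j < p) `|row j a|).

Definition subdifferential (R : realType) (m n : nat)
    (phi : 'M[R]_(m, n) -> R) (A : 'M[R]_(m, n)) : set 'M[R]_(m, n) :=
  [set G | forall B : 'M[R]_(m, n),
    phi A + \sum_(i < m) \sum_(j < n) G i j * (B i j - A i j) <= phi B].

Definition is_density (R : realType) (d : measure_display)
    (T : measurableType d) (P : probability T R) (X : {RV P >-> R})
    (f : R -> R) : Prop :=
  [/\ measurable_fun setT f,
      forall r, 0 <= f r &
      forall A, measurable A ->
        distribution P X A = (\int[lebesgue_measure]_(r in A) (f r)%:E)%E].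

(* Main.v *)
Require Import Defs.
From mathcomp Require Import all_boot all_order all_algebra.
From mathcomp Require Import all_classical all_reals all_analysis.
Import Order.TTheory GRing.Theory Num.Theory.
Import numFieldNormedType.Exports.
Local Open Scope classical_set_scope.
Local Open Scope ring_scope.

(** Write G for the gradient of the cost in the matrix a at 0. The
    subdifferential inclusion asks that the linear form B |-> - <G, B> be
    dominated by the penalty, which vanishes at 0. The penalty is a sum over
    the rows, so one row suffices: splitting <g, b> with the weights 1 - sigma
    and sigma and applying to the two parts the two Hoelder inequalities
      |<g, b>| <= |g|_oo |b|_1   and   |<g, b>| <= |g|_1 |b|_oo
    gives
      |<g, b>| <= (1 - sigma) |g|_oo |b|_1 + sigma |g|_1 |b|_oo
               <= lamL |b|_1 + lamG |b|_oo
    ([dot_le_lasso_norms], [subdifferential_penalty0]). The argument is a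
    duality of norms and applies to any matrix G that satisfies the two row
    bounds.

    The lower bounds on lamL and lamG hold at all mu in the box and all C with
    entries 0 and 1, so it remains to choose one such pair that is feasible:
    mu = 0, and for C a labelling of the leaves by classes in which every class
    occurs, which exists because there are at least as many leaves as classes
    ([labelling_feasible]). *)

Section Duality.
Context {R : realType}.

Lemma normr_entry_le_norm (n : nat) (v : 'rV[R]_n) (t : 'I_n) :
  `|v ord0 t| <= `|v|.
Proof.
rewrite [leRHS]/Num.norm /= mx_normrE.
by rewrite (le_bigmax _ (fun k => `|v k.1 k.2|) (ord0, t)).
Qed.

Lemma hoelder_norm1_max (n : nat) (g b : 'rV[R]_n) :
  `|\sum_(t < n) g ord0 t * b ord0 t| <= norm1 g * `|b|.
Proof.
rewrite (le_trans (ler_norm_sum _ _ _))// /norm1 mulr_suml ler_sum// => t _.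
by rewrite normrM ler_wpM2l// normr_entry_le_norm.
Qed.

Lemma dot_le_lasso_norms (n : nat) (sigma lamL lamG : R) (g b : 'rV[R]_n) :
  0 <= sigma <= 1 -> (1 - sigma) * `|g| <= lamL -> sigma * norm1 g <= lamG ->
  `|\sum_(t < n) g ord0 t * b ord0 t| <= lamL * norm1 b + lamG * `|b|.
Proof.
move=> /andP[s0 s1] hL hG; set S := `|_|.
have -> : S = (1 - sigma) * S + sigma * S by rewrite -mulrDl subrK mul1r.
have b1_ge0 : 0 <= norm1 b by exact: sumr_ge0.
apply: lerD.
- apply: le_trans (ler_wpM2r b1_ge0 hL).
  rewrite -mulrA ler_wpM2l ?subr_ge0// mulrC /S.
  under eq_bigr do rewrite mulrC.
  exact: hoelder_norm1_max.
- apply: le_trans (ler_wpM2r (normr_ge0 b) hG).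
  by rewrite -mulrA ler_wpM2l// hoelder_norm1_max.
Qed.

(** The penalty vanishes at 0 and is a sum over rows, so the inclusion reduces
    to [dot_le_lasso_norms] for each row; that lemma bounds an absolute value,
    which is why bounds on the rows of G yield a subgradient - G. *)
Lemma subdifferential_penalty0 (m n : nat) (sigma lamL lamG : R)
    (G : 'M[R]_(m, n)) :
  0 <= sigma <= 1 ->
  (forall j, (1 - sigma) * `|row j G| <= lamL) ->
  (forall j, sigma * norm1 (row j G) <= lamG) ->
  subdifferential (penalty lamL lamG) 0 (- G).
Proof.
move=> hs hL hG B.
have -> : penalty lamL lamG (0 : 'M[R]_(m, n)) = 0.
  rewrite /penalty !big1 ?mulr0 ?addr0// => j _.
    by rewrite row0 normr0.
  by rewrite row0 /norm1 big1// => t _; rewrite mxE normr0.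
rewrite add0r /penalty !mulr_sumr -big_split/= ler_sum// => j _.
have := dot_le_lasso_norms n sigma lamL lamG (row j G) (row j B) hs (hL j) (hG j).
rewrite -[leLHS]normrN -sumrN; apply: le_trans; apply: le_trans (ler_norm _).
by apply: ler_sum => t _; rewrite !mxE subr0 mulNr.
Qed.

End Duality.

Section Labelling.
Context {R : realType} {D K : nat}.

Definition labelling_mx (c : 'I_(num_leaf D) -> 'I_K) :
    'M[R]_(K, num_leaf D) :=
  \matrix_(k, t) (k == c t)%:R.

(** Each class k labels some leaf, and that leaf alone already contributes 1 to
    the k-th coverage constraint. *)
Lemma labelling_feasible (p : nat) (c : 'I_(num_leaf D) -> 'I_K) :
  (forall k, exists t, c t = k) ->
  feasible (0 : 'M[R]_(p, num_branch D)) 0 (labelling_mx c).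
Proof.
move=> c_surj; split.
- move=> t; rewrite (bigD1 (c t))//= mxE eqxx big1 ?addr0// => k /negbTE ck.
  by rewrite mxE ck.
- move=> k; have [t ct] := c_surj k.
  by rewrite (bigD1 t)//= mxE ct eqxx lerDl sumr_ge0// => s _; rewrite mxE.
- by move=> j t; rewrite mxE lerN10 ler01.
- by move=> t; rewrite mxE lerN10 ler01.
- by move=> k t; rewrite mxE ler0n lern1 leq_b1.
Qed.

Lemma exists_surjective_labelling : (1 <= K)%N -> (K <= 2 ^ D)%N ->
  exists c : 'I_(num_leaf D) -> 'I_K, forall k, exists t, c t = k.
Proof.
move=> K_gt0 K_le.
(* Leaf t < K gets class t; the remaining leaves get class 0. *)
exists (fun t => insubd (Ordinal K_gt0) (val t)) => k.
by exists (widen_ord K_le k); apply: val_inj; rewrite val_insubd /= ltn_ord.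
Qed.

End Labelling.

Theorem theorem2 (R : realType) (D N p K : nat)
  (hD : (1 <= D)%N) (hN : (1 <= N)%N) (hp : (1 <= p)%N) (hK : (1 <= K)%N)
  (hKD : (K <= 2 ^ D)%N)
  (x : 'I_N -> 'cV[R]_p) (hx : forall i j, 0 <= x i j ord0 <= 1)
  (y : 'I_N -> 'I_K) (W : 'M[R]_K)
  (d : measure_display) (T : measurableType d) (P : probability T R)
  (X : {RV P >-> R}) (F f : R -> R)
  (hF : forall r, (F r)%:E = cdf X r)
  (hf : is_density X f)
  (hFf : forall r, is_derive r (1 : R) F (f r))
  (lamL lamG : R) (hlamL : 0 <= lamL) (hlamG : 0 <= lamG)
  (sigma : R) (hsigma : 0 <= sigma <= 1)
  (hL : forall (mu : 'rV[R]_(num_branch D)) (C : 'M[R]_(K, num_leaf D))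
          (j : 'I_p),
      (forall t, -1 <= mu ord0 t <= 1) ->
      (forall k t, C k t = 0 \/ C k t = 1) ->
      (1 - sigma) * `|row j (gradient (fun a => cost F x y W a mu C) 0)|
        <= lamL)
  (hG : forall (mu : 'rV[R]_(num_branch D)) (C : 'M[R]_(K, num_leaf D))
          (j : 'I_p),
      (forall t, -1 <= mu ord0 t <= 1) ->
      (forall k t, C k t = 0 \/ C k t = 1) ->
      sigma * norm1 (row j (gradient (fun a => cost F x y W a mu C) 0))
        <= lamG) :
  exists (mu : 'rV[R]_(num_branch D)) (C : 'M[R]_(K, num_leaf D)),
    feasible (0 : 'M[R]_(p, num_branch D)) mu C /\
    subdifferential (penalty lamL lamG) 0
      (- gradient (fun a => cost F x y W a mu C) 0).
Proof.
have [c c_surj] := exists_surjective_labelling hK hKD.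
have mu_box t : -1 <= (0 : 'rV[R]_(num_branch D)) ord0 t <= 1.
  by rewrite mxE lerN10 ler01.
have C01 k t : (labelling_mx c : 'M[R]__) k t = 0 \/
               (labelling_mx c : 'M[R]__) k t = 1.
  by rewrite mxE; case: eqP; [right | left].
exists 0, (labelling_mx c); split; first exact: labelling_feasible.
apply: (subdifferential_penalty0 _ _ _ _ _ _ hsigma) => j.
- exact: hL.
- exact: hG.
Qed.
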